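(* Let $p$ be an odd prime, let $q\in\mathbb{C}_p$ with $|1-q|_p<1$, let $\chi$ be a Dirichlet character with conductor $f\in\mathbb{N}$, $f\equiv 1\pmod 2$, let $r\in\mathbb{N}$, $n\in\mathbb{Z}_+$, and $x\in\mathbb{Z}_p$. Define $$E_{n,\chi,q}^{(r)}(x)=\int_X\cdots\int_X\Big(\prod_{i=1}^r\chi(x_i)\Big)[x_1+\cdots+x_r+x]_q^n\,d\mu_1(x_1)\cdots d\mu_1(x_r).$$ Then $$\begin{aligned}E_{n,\chi,q}^{(r)}(x)&=\frac{2^r}{(1-q)^n}\sum_{l=0}^n\binom{n}{l}q^{lx}(-1)^l\sum_{a_1,\ldots,a_r=0}^{f-1}\Big(\prod_{j=1}^r\chi(a_j)\Big)\frac{(-q^l)^{\sum_{i=1}^r a_i}}{(1+q^{lf})^r}\\&=2^r\sum_{m=0}^{\infty}\binom{m+r-1}{m}(-1)^m\sum_{a_1,\ldots,a_r=0}^{f-1}\Big(\prod_{j=1}^r\chi(a_j)\Big)(-1)^{\sum_{i=1}^r a_i}\Big[\sum_{j=1}^r a_j+x+mf\Big]_q^n\\&=2^r\sum_{m_1,\ldots,m_r=0}^{\infty}(-1)^{m_1+\cdots+m_r}\Big(\prod_{i=1}^r\chi(m_i)\Big)[x+m_1+\cdots+m_r]_q^n.\end{aligned}$$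
   Context: $\mathbb{C}_p$ is the completion of the algebraic closure of $\mathbb{Q}_p$; $[x]_q=\frac{1-q^x}{1-q}$. $X=\varprojlim_N \mathbb{Z}/fp^N\mathbb{Z}$, and for a uniformly differentiable $g:X\to\mathbb{C}_p$ the fermionic $p$-adic integral is $\int_X g(x)\,d\mu_1(x)=\lim_{N\to\infty}\sum_{x=0}^{fp^N-1}g(x)(-1)^x$; multiple integrals are iterated. $\chi$ is viewed as a function on $X$ via reduction modulo $f$.
   Formalization: The infinite series in lines 2 and 3 diverge p-adically (f=r=1, n=0 gives 2(1-1+1-...)); they are read as regularised sums via the generating function at t=1, which agree with ordinary sums when convergent, and the r-fold series is summed iteratively. *)

(* Defs.v *)
From mathcomp Require Import all_boot all_order all_algebra.
From mathcomp Require Import all_classical all_reals topology normedtype sequences.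

Set Implicit Arguments.
Unset Strict Implicit.
Unset Printing Implicit Defensive.

Import Order.TTheory GRing.Theory Num.Theory.
Import numFieldNormedType.Exports.

Local Open Scope classical_set_scope.
Local Open Scope ring_scope.

(* In what follows K carries an absolute value v : K -> R.  MathComp's
   normed modules do not apply, since their norms satisfy
   `|x *+ n| = `|x| *+ n; convergence in K is therefore expressed by the
   convergence to 0 in R of the distance. *)

Definition pcvg (R : realType) (K : fieldType) (v : K -> R)
    (u : nat -> K) (l : K) : Prop :=
  v (u n - l) @[n --> \oo] --> (0 : R).

Definition pcauchy (R : realType) (K : fieldType) (v : K -> R)
    (u : nat -> K) : Prop :=
  forall e : R, 0 < e -> exists N : nat,
    forall m n : nat, (N <= m)%N -> (N <= n)%N -> v (u m - u n) < e.

(* The limit, when it exists. *)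
Definition plim (R : realType) (K : fieldType) (v : K -> R)
    (u : nat -> K) : K :=
  xget 0 [set l | pcvg v u l].

(* Closure in K of the prime subfield: this is Q_p when K is complete and v
   restricts to the p-adic absolute value. *)
Definition in_Qp (R : realType) (K : fieldType) (v : K -> R) (y : K) : Prop :=
  forall e : R, 0 < e -> exists c : rat, v (y - ratr c) < e.

Definition in_Zp (R : realType) (K : fieldType) (v : K -> R) (y : K) : Prop :=
  forall e : R, 0 < e -> exists c : int, v (y - c%:~R) < e.

Definition algebraic_over_Qp (R : realType) (K : fieldType) (v : K -> R)
    (y : K) : Prop :=
  exists P : {poly K}, [/\ P != 0, forall i, in_Qp v P`_i & root P y].

(* (K, v) is the completion of the algebraic closure of Q_p.  As K is
   algebraically closed, the elements of K algebraic over Q_p form an algebraic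
   closure of Q_p; K is complete and they are dense in it.  This determines
   (K, v) up to isometric isomorphism. *)
Record is_Cp (R : realType) (p : nat) (K : closedFieldType) (v : K -> R) :
    Prop := IsCp {
  Cp_ge0 : forall a, 0 <= v a;
  Cp_eq0 : forall a, v a = 0 <-> a = 0;
  Cp_mul : forall a b, v (a * b) = v a * v b;
  Cp_ultrametric : forall a b, v (a + b) <= Num.max (v a) (v b);
  Cp_normalized : v p%:R = p%:R^-1;
  Cp_complete : forall u : nat -> K, pcauchy v u -> exists l, pcvg v u l;
  Cp_dense : forall (a : K) (e : R), 0 < e ->
    exists2 b, algebraic_over_Qp v b & v (a - b) < e
}.

(* q ^ z for z in Z_p and v (1 - q) < 1: the continuous extension to Z_p of
   m |-> q ^+ m, i.e. the limit of q ^+ m as the natural number m tends to z. *)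
Definition qpow (R : realType) (K : fieldType) (v : K -> R) (q z : K) : K :=
  xget 0 [set y | forall e : R, 0 < e -> exists2 d : R, 0 < d &
    forall m : nat, v (z - m%:R) < d -> v (y - q ^+ m) < e].

(* At q = 1 the quotient is 0 by the convention 0^-1 = 0. *)
Definition qnum (R : realType) (K : fieldType) (v : K -> R) (q z : K) : K :=
  (1 - qpow v q z) / (1 - q).

(* chi takes values in K and is extended by 0 to the integers not coprime to
   the modulus f. *)
Record dirichlet_character (K : fieldType) (f : nat) (chi : int -> K) : Prop :=
    DirichletCharacter {
  dchar_periodic : forall a b : int, (a = b %[mod f])%Z -> chi a = chi b;
  dchar_mul : forall a b : int, chi (a * b) = chi a * chi b;
  dchar1 : chi 1 = 1;
  dchar_eq0 : forall a : int, chi a = 0 <-> ~~ coprimez a f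
}.

(* chi, of modulus f, is not induced by a character of smaller modulus. *)
Definition has_conductor (K : fieldType) (f : nat) (chi : int -> K) : Prop :=
  dirichlet_character f chi /\
  forall d : nat, (d %| f)%N ->
    (forall a b : int, coprimez a f -> coprimez b f ->
       (a = b %[mod d])%Z -> chi a = chi b) ->
    d = f.

(* The projective limit X of the Z/fp^N.  The component at N is the
   representative in [0, fp^N[; that it lies in this range is a consequence of
   the compatibility condition. *)
Record Xspace (f p : nat) := MkXspace {
  Xcomp :> nat -> nat;
  Xcompat : forall N, (Xcomp N.+1 %% (f * p ^ N))%N = Xcomp N
}.

Lemma Xnat_compat (f p k N : nat) :
  ((k %% (f * p ^ N.+1)) %% (f * p ^ N) = k %% (f * p ^ N))%N.
Proof. by rewrite modn_dvdm // expnS mulnCA dvdn_mull. Qed.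

Definition Xnat (f p k : nat) : Xspace f p :=
  @MkXspace f p (fun N => k %% (f * p ^ N))%N (Xnat_compat f p k).

(* The projection X -> Z_p, with Z_p inside K. *)
Definition XtoZp (R : realType) (K : fieldType) (v : K -> R) (f p : nat)
    (x : Xspace f p) : K :=
  plim v (fun N => (x N)%:R).

(* The component of x at 0 is its reduction modulo f. *)
Definition chiX (K : fieldType) (f p : nat) (chi : int -> K)
    (x : Xspace f p) : K :=
  chi (x 0%N)%:Z.

Definition fermionic_sum (K : fieldType) (f p : nat) (g : Xspace f p -> K)
    (N : nat) : K :=
  \sum_(k < f * p ^ N) g (Xnat f p k) * (-1) ^+ k.

Definition fermionic_integrable (R : realType) (K : fieldType) (v : K -> R)
    (f p : nat) (g : Xspace f p -> K) : Prop :=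
  exists l, pcvg v (fermionic_sum g) l.

Definition fermionic_integral (R : realType) (K : fieldType) (v : K -> R)
    (f p : nat) (g : Xspace f p -> K) : K :=
  plim v (fermionic_sum g).

(* Iteration of an integral or summation operator op over r variables;
   the operator for the first variable is outermost. *)
Fixpoint iterated (T K : Type) (op : (T -> K) -> K) (r : nat) :
    (r.-tuple T -> K) -> K :=
  match r return (r.-tuple T -> K) -> K with
  | 0 => fun F => F [tuple]
  | _.+1 => fun F =>
      op (fun t => iterated op (fun ts => F [tuple of t :: ts]))
  end.

(* All the applications of op occurring in iterated op F are to functions in
   the domain dom of op. *)
Fixpoint iterated_defined (T K : Type) (dom : (T -> K) -> Prop)
    (op : (T -> K) -> K) (r : nat) : (r.-tuple T -> K) -> Prop :=
  match r return (r.-tuple T -> K) -> Prop with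
  | 0 => fun F => True
  | _.+1 => fun F =>
      (forall t, iterated_defined dom op (fun ts => F [tuple of t :: ts])) /\
      dom (fun t => iterated op (fun ts => F [tuple of t :: ts]))
  end.

(* Alternating series such as 1 - 1 + 1 - ... = 1/2, whose terms do not tend
   to 0 in K, are summed through their generating function: the sum of a is S
   if, for some polynomial Q with Q(1) != 0, the coefficients of the power
   series Q(t) * \sum_m a_m t^m form a series converging in K to Q(1) S.  With
   Q = 1 this is ordinary convergence; when the generating function is a
   rational function regular at t = 1, S is its value there.  The sum is unique
   (has_gsum_unique below). *)
Definition has_gsum (R : realType) (K : fieldType) (v : K -> R)
    (a : nat -> K) (S : K) : Prop :=
  exists2 Q : {poly K}, Q.[1] != 0 &
    pcvg v (fun M => \sum_(m < M) \sum_(i < m.+1) Q`_i * a (m - i)%N)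
           (Q.[1] * S).

Definition gsummable (R : realType) (K : fieldType) (v : K -> R)
    (a : nat -> K) : Prop :=
  exists S, has_gsum v a S.

Definition gsum (R : realType) (K : fieldType) (v : K -> R)
    (a : nat -> K) : K :=
  xget 0 [set S | has_gsum v a S].

Definition euler_integrand (R : realType) (K : fieldType) (v : K -> R)
    (f p : nat) (chi : int -> K) (q : K) (r n : nat) (x : K)
    (xs : r.-tuple (Xspace f p)) : K :=
  (\prod_(i < r) chiX chi (tnth xs i)) *
  qnum v q (\sum_(i < r) XtoZp v (tnth xs i) + x) ^+ n.

Definition euler_poly (R : realType) (K : fieldType) (v : K -> R)
    (f p : nat) (chi : int -> K) (q : K) (r n : nat) (x : K) : K :=
  iterated (@fermionic_integral R K v f p)
    (euler_integrand v chi q n x (r := r)).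

Definition euler_poly_defined (R : realType) (K : fieldType) (v : K -> R)
    (f p : nat) (chi : int -> K) (q : K) (r n : nat) (x : K) : Prop :=
  iterated_defined (@fermionic_integrable R K v f p)
    (@fermionic_integral R K v f p)
    (euler_integrand v chi q n x (r := r)).

Section GsumUnique.
Variables (R : realType) (p : nat) (K : closedFieldType) (v : K -> R).
Hypothesis hK : is_Cp p v.

Let vN1 : v (-1) = 1.
Proof.
have v1 : v 1 = 1.
  have v1n0 : v 1 != 0 by apply/eqP => /(Cp_eq0 hK) /eqP; rewrite oner_eq0.
  by apply: (mulIf v1n0); rewrite -(Cp_mul hK) !mul1r.
apply/eqP; rewrite -(@eqrXn2 _ 2) ?(Cp_ge0 hK) // expr1n expr2.
by rewrite -(Cp_mul hK) mulrNN mulr1 v1.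
Qed.

Let vN a : v (- a) = v a.
Proof. by rewrite -mulN1r (Cp_mul hK) vN1 mul1r. Qed.

Let vD a b : v (a + b) <= v a + v b.
Proof.
apply: (le_trans (Cp_ultrametric hK a b)).
by rewrite ge_max lerDl lerDr !(Cp_ge0 hK).
Qed.

Lemma pcvg_unique (u : nat -> K) (l l' : K) : pcvg v u l -> pcvg v u l' -> l = l'.
Proof.
move=> ul ul'; apply/eqP; rewrite -subr_eq0; apply/eqP/(Cp_eq0 hK).
have H : (fun n => v (u n - l) + v (u n - l')) @ \oo --> (0 : R).
  by rewrite -[0]addr0; apply: cvgD.
have H0 : (fun _ : nat => v (l - l')) @ \oo --> (0 : R).
  apply: (squeeze_cvgr _ (cvg_cst 0) H); near=> n.
  rewrite (Cp_ge0 hK) /= -(vN (u n - l)).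
  by apply: le_trans (vD _ _); rewrite opprB addrA subrK.
by apply: (cvg_unique (@norm_hausdorff _ R^o) _ H0); exact: cvg_cst.
Unshelve. all: by end_near. Qed.

Lemma pcvgD (u w : nat -> K) (l m : K) :
  pcvg v u l -> pcvg v w m -> pcvg v (fun n => u n + w n) (l + m).
Proof.
move=> ul wm.
have H : (fun n => v (u n - l) + v (w n - m)) @ \oo --> (0 : R).
  by rewrite -[0]addr0; apply: cvgD.
apply: (squeeze_cvgr _ (cvg_cst 0) H); near=> n.
by rewrite (Cp_ge0 hK) /= opprD addrACA vD.
Unshelve. all: by end_near. Qed.

Lemma pcvgZ (a : K) (u : nat -> K) (l : K) : pcvg v u l -> pcvg v (fun n => a * u n) (a * l).
Proof.
move=> ul; rewrite /pcvg.
under eq_fun do rewrite -mulrBr (Cp_mul hK).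
by rewrite -[0](mulr0 (v a)); apply: cvgM => //; exact: cvg_cst.
Qed.

Lemma pcvg_sum (k : nat) (u : nat -> nat -> K) (l : nat -> K) :
  (forall i, pcvg v (u i) (l i)) ->
  pcvg v (fun n => \sum_(i < k) u i n) (\sum_(i < k) l i).
Proof.
move=> ul; elim: k => [|k IHk].
  rewrite /pcvg; under eq_fun do rewrite !big_ord0 subr0.
  by rewrite (_ : v 0 = 0); [exact: cvg_cst | exact/(Cp_eq0 hK)].
rewrite big_ord_recr /=.
rewrite (_ : (fun _ => _) = fun n => \sum_(i < k) u i n + u k n).
  exact: pcvgD.
by apply/funext => n; rewrite big_ord_recr.
Qed.

Let conv (Q : {poly K}) (a : nat -> K) (m : nat) : K :=
  \sum_(i < m.+1) Q`_i * a (m - i)%N.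

Let conv_sum (Q : {poly K}) (c : nat -> K) (M : nat) : \sum_(m < M) conv Q c m =
  \sum_(i < size Q) Q`_i * \sum_(m < M - i) c m.
Proof.
elim: M => [|M IHM].
  by rewrite big_ord0 big1 // => i _; rewrite sub0n big_ord0 mulr0.
rewrite big_ord_recr /= IHM /conv.
pose d i := if (i <= M)%N then c (M - i)%N else 0.
have -> : \sum_(i < M.+1) Q`_i * c (M - i)%N = \sum_(i < size Q) Q`_i * d i.
  transitivity (\sum_(i < M.+1 + size Q) Q`_i * d i).
    rewrite big_split_ord /= [X in _ + X]big1 ?addr0; last first.
      move=> i _; rewrite /d ifF ?mulr0 //.
      by apply/negbTE; rewrite -ltnNge ltn_addr.
    by apply: eq_bigr => i _; rewrite /d -ltnS ltn_ord.
  rewrite addnC big_split_ord /= [X in _ + X]big1 ?addr0 // => i _.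
  by rewrite nth_default ?mul0r // leq_addr.
rewrite -big_split /=; apply: eq_bigr => i _; rewrite -mulrDr /d.
case: leqP => iM; first by rewrite subSn // big_ord_recr.
have -> : (M.+1 - i = 0)%N by apply/eqP; rewrite subn_eq0.
have -> : (M - i = 0)%N by apply/eqP; rewrite subn_eq0 ltnW.
by rewrite addr0.
Qed.

Let conv_cvg (Q : {poly K}) (c : nat -> K) (L : K) :
  pcvg v (fun M => \sum_(m < M) c m) L ->
  pcvg v (fun M => \sum_(m < M) conv Q c m) (Q.[1] * L).
Proof.
move=> cL; rewrite (_ : (fun _ => _) = fun M =>
    \sum_(i < size Q) Q`_i * \sum_(m < M - i) c m); last first.
  by apply/funext => M; exact: conv_sum.
rewrite horner_coef mulr_suml.
rewrite [X in pcvg _ _ X](_ : _ = \sum_(i < size Q) Q`_i * L); last first.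
  by apply: eq_bigr => i _; rewrite expr1n mulr1.
apply: (@pcvg_sum _ (fun i M => Q`_i * \sum_(m < M - i) c m)
  (fun i => Q`_i * L)) => i.
apply: pcvgZ; rewrite /pcvg.
by rewrite (cvg_centern i (fun M => v (\sum_(m < M) c m - L)) (nbhs (0 : R))).
Qed.

Let convE (Q : {poly K}) (a : nat -> K) (m B : nat) :
  (m < B)%N -> conv Q a m = (Q * \poly_(i < B) a i)`_m.
Proof.
move=> mB; rewrite coefM; apply: eq_bigr => i _.
by rewrite coef_poly (leq_ltn_trans (leq_subr _ _) mB).
Qed.

Let conv2E (Q Q' : {poly K}) (a : nat -> K) (m : nat) :
  conv Q' (conv Q a) m = (Q' * (Q * \poly_(i < m.+1) a i))`_m.
Proof.
rewrite coefM; apply: eq_bigr => i _; congr (_ * _).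
by apply: convE; rewrite ltnS leq_subr.
Qed.

Lemma has_gsum_unique (a : nat -> K) (S S' : K) : has_gsum v a S -> has_gsum v a S' -> S = S'.
Proof.
move=> [Q Q1 H] [Q' Q1' H'].
have {}H := @conv_cvg Q' (conv Q a) _ H.
have {}H' := @conv_cvg Q (conv Q' a) _ H'.
have E : (fun M => \sum_(m < M) conv Q' (conv Q a) m) =
         (fun M => \sum_(m < M) conv Q (conv Q' a) m).
  by apply/funext => M; apply: eq_bigr => m _; rewrite !conv2E mulrCA.
rewrite -E in H'.
have := pcvg_unique H H'; rewrite mulrCA => /(mulfI Q1)/(mulfI Q1') //.
Qed.

End GsumUnique.

(* Main.v *)
(* Expanding [z]_q^n by the binomial theorem turns each of the r-fold integrals
   and sums into a finite combination, over 0 <= l <= n, of r-th powers of the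
   one-variable integral or sum of chi(k) y^k, where y = - q^l.  With T the sum
   of chi(k) y^k over k < f, the partial sum over k < f M is
   T (1 - y^(f M)) / (1 - y^f).  For M = p^N the numerator factor is
   1 + q^(l f p^N), which tends to 2, whereas the generating series is rational,
   with value T / (1 - y^f) at 1.  The series in the single index m is, in the
   same way, a combination of the negative binomial series (1 - y^f t)^(-r) at
   t = 1. *)
Require Import Defs.
From mathcomp Require Import all_boot all_order all_algebra.
From mathcomp Require Import all_classical all_reals topology normedtype sequences.
From mathcomp Require Import ring.

Set Implicit Arguments.
Unset Strict Implicit.

Import Order.TTheory GRing.Theory Num.Theory.
Import numFieldNormedType.Exports.
Local Open Scope ring_scope.

Lemma expr_lt_eventually (R : realType) (rho : R) (e : R) :
  0 <= rho < 1 -> 0 < e -> exists N, forall n, (N <= n)%N -> rho ^+ n < e.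
Proof.
move=> /andP[rho0 rho1] e0.
have /cvgr0Pnorm_lt/(_ e e0)[N _ HN] : (rho ^+ n @[n --> \oo] --> (0 : R))%classic.
  by apply: cvg_expr; rewrite ger0_norm.
by exists N => n /HN; apply: le_lt_trans; exact: ler_norm.
Qed.

(** * The absolute value on K: ultrametric estimates and divisibility by p *)

Section Cp.
Variables (R : realType) (p : nat) (K : closedFieldType) (v : K -> R).
Hypothesis hK : is_Cp p v.

Lemma v0 : v 0 = 0. Proof. exact/(Cp_eq0 hK). Qed.

Lemma v1 : v 1 = 1.
Proof.
have v1n0 : v 1 != 0 by apply/eqP => /(Cp_eq0 hK) /eqP; rewrite oner_eq0.
by apply: (mulIf v1n0); rewrite -(Cp_mul hK) !mul1r.
Qed.

Lemma vN a : v (- a) = v a.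
Proof.
apply/eqP; rewrite -(@eqrXn2 _ 2) ?(Cp_ge0 hK) // !expr2 -!(Cp_mul hK).
by rewrite mulrNN.
Qed.

Lemma v_distrC a b : v (a - b) = v (b - a).
Proof. by rewrite -vN opprB. Qed.

Lemma vX a n : v (a ^+ n) = v a ^+ n.
Proof. by elim: n => [|n IHn]; rewrite ?v1 // !exprS (Cp_mul hK) IHn. Qed.

Lemma vD_lt a b e : v a < e -> v b < e -> v (a + b) < e.
Proof.
by move=> ae be; apply: le_lt_trans (Cp_ultrametric hK a b) _; rewrite gt_max ae.
Qed.

Lemma vD_le a b e : v a <= e -> v b <= e -> v (a + b) <= e.
Proof.
by move=> ae be; apply: le_trans (Cp_ultrametric hK a b) _; rewrite ge_max ae.
Qed.

Lemma vB_lt_trans b a c e : v (a - b) < e -> v (b - c) < e -> v (a - c) < e.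
Proof. by move=> ab bc; rewrite -(subrKA b); exact: vD_lt. Qed.

Lemma v_sum_le (I : Type) (s : seq I) (F : I -> K) e :
  0 <= e -> (forall i, v (F i) <= e) -> v (\sum_(i <- s) F i) <= e.
Proof.
move=> e0 He; elim/big_ind: _ => //; first by rewrite v0.
by move=> *; exact: vD_le.
Qed.

Lemma v_nat_le1 m : v m%:R <= 1.
Proof.
elim: m => [|m IHm]; first by rewrite v0.
by rewrite -natr1; apply: vD_le => //; rewrite v1.
Qed.

Lemma v_eq (a b : K) : (forall e, 0 < e -> v (a - b) < e) -> a = b.
Proof.
move=> H; apply/eqP; rewrite -subr_eq0; apply/eqP/(Cp_eq0 hK)/eqP.
rewrite eq_le (Cp_ge0 hK) andbT leNgt; apply/negP => /H.
by rewrite ltxx.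
Qed.

Lemma pcvgP (u : nat -> K) l : pcvg v u l <->
  (forall e, 0 < e -> exists N, forall n, (N <= n)%N -> v (u n - l) < e).
Proof.
split=> [/cvgr0Pnorm_lt H e /H[N _ HN]|H].
  by exists N => n /HN; apply: le_lt_trans; exact: ler_norm.
apply/cvgr0Pnorm_lt => e /H[N HN]; exists N => // n /HN.
by rewrite /= ger0_norm ?(Cp_ge0 hK).
Qed.

Lemma plimE (u : nat -> K) l : pcvg v u l -> plim v u = l.
Proof.
by move=> ul; apply: xget_unique => // y /pcvg_unique/(_ ul); apply; exact: hK.
Qed.

Hypothesis hp : prime p.

Let p_gt0 : 0 < p%:R :> R. Proof. by rewrite ltr0n prime_gt0. Qed.

Lemma vp_itv : 0 <= (p%:R^-1 : R) < 1.
Proof.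
by rewrite invr_ge0 ltW //= invf_lt1 // ltr1n prime_gt1.
Qed.

Lemma v_dvdn k m : (p ^ k %| m)%N -> v m%:R <= p%:R^-1 ^+ k.
Proof.
move=> /dvdnP[c ->]; rewrite natrM (Cp_mul hK) natrX vX (Cp_normalized hK).
by rewrite ler_piMl ?v_nat_le1 // exprn_ge0 //; case/andP: vp_itv.
Qed.

(** By Bezout some multiple of [p] exceeds some multiple of [m] by 1; were [v m] below 1, both
    multiples, hence 1 itself, would have absolute value below 1. *)
Lemma v_coprime m : coprime p m -> v m%:R = 1.
Proof.
move=> /(coprimeP _ (prime_gt0 hp)) [[a b] /= H].
apply/eqP; rewrite eq_le v_nat_le1 leNgt; apply/negP => vm.
have : v (1%N%:R) < 1.
  rewrite -H natrB; last by rewrite ltnW // -subn_gt0 H.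
  apply: vD_lt; rewrite ?vN natrM (Cp_mul hK).
    rewrite (Cp_normalized hK); apply: le_lt_trans (_ : p%:R^-1 < 1).
      by rewrite ler_piMl ?v_nat_le1 //; case/andP: vp_itv.
    by case/andP: vp_itv.
  by apply: le_lt_trans vm; rewrite ler_piMl ?v_nat_le1 // (Cp_ge0 hK).
by rewrite v1 ltxx.
Qed.

(** Once the prime-to-[p] factor of [m] is split off, [v m] is exactly the inverse of a power of
    [p], so smallness can be read back as divisibility. *)
Lemma dvdn_v k m : v m%:R < p%:R^-1 ^+ k -> (p ^ k %| m)%N.
Proof.
have [->|m0] := posnP m; first by rewrite dvdn0.
have [u pu ->] := pfactor_coprime hp m0.
rewrite natrM (Cp_mul hK) v_coprime // mul1r natrX vX (Cp_normalized hK) => H.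
apply/dvdn_mull/dvdn_exp2l/ltnW; move: H; apply: contraTltn => H.
rewrite -leNgt; case/andP: vp_itv => p0 /ltW p1.
exact: ler_wiXn2l.
Qed.

Lemma v2 : odd p -> v 2 = 1.
Proof. by move=> op; apply: v_coprime; rewrite coprimen2. Qed.

(** * Powers of a base close to 1 *)

Section Base.
Variable (q : K).
Hypothesis hq : v (1 - q) < 1.

Lemma v_base : v q = 1.
Proof.
have le1 : v q <= 1.
  by rewrite -[q](subKr 1); apply: vD_le; rewrite ?vN ?v1 // ltW.
apply/eqP; rewrite eq_le le1 leNgt; apply/negP => q1.
by have := vD_lt hq q1; rewrite subrK v1 ltxx.
Qed.

Lemma v_baseX_lt n : v (1 - q ^+ n) < 1.
Proof.
elim: n => [|n IHn]; first by rewrite subrr v0.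
rewrite -(subrKA q); apply: vD_lt => //.
by rewrite exprS -{1}[q]mulr1 -mulrBr (Cp_mul hK) v_base mul1r.
Qed.

Let rho := Num.max (v (1 - q)) p%:R^-1.

Let rho_itv : 0 <= rho < 1.
Proof.
by rewrite gt_max hq le_max; case/andP: vp_itv => -> ->; rewrite orbT.
Qed.

(** The factorisation [X^p - 1 = (X - 1)(1 + ... + X^(p-1))] at [X = q^(p^k)] gains a factor [rho]
    at each step: the second factor is within [v (1 - q)] of [p], whose absolute value is [1/p]. *)
Lemma v_baseXX k m : v (1 - q ^+ (p ^ k * m)) <= rho ^+ k.
Proof.
have /andP[r0 r1] := rho_itv.
(* [1 - q^(p^k)] divides [1 - q^(p^k j)] with a cofactor of absolute value at most 1, which reduces
   the claim to [m = 1]. *)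
have H j : v (1 - q ^+ (p ^ k * j)) <= v (1 - q ^+ (p ^ k)).
  rewrite v_distrC exprM subrX1 (Cp_mul hK) v_distrC ler_piMr ?(Cp_ge0 hK) //.
  by apply: v_sum_le => // i; rewrite !vX v_base !expr1n.
apply: (le_trans (H m)); elim: k {H} => [|k IHk].
  by rewrite expn0 expr1 expr0 ltW.
rewrite v_distrC expnSr exprM subrX1 (Cp_mul hK) v_distrC exprSr.
apply: ler_pM => //; rewrite ?(Cp_ge0 hK) //.
rewrite -[X in v X](subrK (p%:R)); apply: vD_le; last first.
  by rewrite (Cp_normalized hK) le_max lexx orbT.
rewrite -[in p%:R](card_ord p) -sumr_const -sumrB; apply: v_sum_le => // i.
rewrite v_distrC -exprM le_max; apply/orP; left.
rewrite v_distrC subrX1 (Cp_mul hK) v_distrC ler_piMr ?(Cp_ge0 hK) //.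
by apply: v_sum_le => // j; rewrite !vX v_base !expr1n.
Qed.

Lemma v_baseXX_lt (e : R) : 0 < e ->
  exists N, forall k m, (N <= k)%N -> v (1 - q ^+ (p ^ k * m)) < e.
Proof.
move=> /(expr_lt_eventually rho_itv)[N HN]; exists N => k m /HN.
by apply: le_lt_trans; exact: v_baseXX.
Qed.

(** For [m <= m'] the difference is, up to sign, [q^m] times [1 - q^(m' - m)], and a high power of
    [p] divides [m' - m]. This is what lets the powers of [q] extend to Z_p. *)
Lemma base_uniform_cont (e : R) : 0 < e -> exists2 d : R, 0 < d &
  forall m m' : nat, v (m%:R - m'%:R) < d -> v (q ^+ m - q ^+ m') < e.
Proof.
move=> /v_baseXX_lt[k Hk]; exists (p%:R^-1 ^+ k).
  by rewrite exprn_gt0 // invr_gt0.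
move=> m m'; wlog mm' : m m' / (m <= m')%N.
  move=> H; have [/H//|/ltnW/H{}H] := leqP m m'.
  by rewrite v_distrC => /H; rewrite v_distrC.
rewrite v_distrC -natrB // => /dvdn_v/dvdnP[c mE].
rewrite -(subnKC mm') mE exprD -[X in X - _]mulr1 -mulrBr.
rewrite (Cp_mul hK) vX v_base expr1n mul1r.
by rewrite mulnC; exact: Hk.
Qed.

End Base.
End Cp.

(** * The p-adic integers inside K and the projection from X *)

Section Zp.
Variables (R : realType) (p : nat) (K : closedFieldType) (v : K -> R).
Hypotheses (hK : is_Cp p v) (hp : prime p).

Lemma pcvg_near_const (u : nat -> K) l N :
  (forall n, (N <= n)%N -> u n = l) -> pcvg v u l.
Proof.
move=> H; apply/(pcvgP hK) => e e0; exists N => n /H ->.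
by rewrite subrr (v0 hK).
Qed.

Lemma in_Zp_nat m : in_Zp v m%:R.
Proof. by move=> e e0; exists m%:Z; rewrite subrr (v0 hK). Qed.

Lemma in_ZpD y z : in_Zp v y -> in_Zp v z -> in_Zp v (y + z).
Proof.
move=> Zy Zz e e0; have [c Hc] := Zy e e0; have [d Hd] := Zz e e0.
by exists (c + d); rewrite intrD opprD addrACA; exact: (vD_lt hK).
Qed.

Lemma in_ZpMn z m : in_Zp v z -> in_Zp v (z *+ m).
Proof.
move=> Zz; elim: m => [|m IHm]; first exact: (in_Zp_nat 0%N).
by rewrite mulrS; exact: in_ZpD.
Qed.

Lemma in_Zp_sum r (z : 'I_r -> K) :
  (forall i, in_Zp v (z i)) -> in_Zp v (\sum_(i < r) z i).
Proof.
by move=> Zz; apply: big_ind => //; [exact: (in_Zp_nat 0%N) | exact: in_ZpD].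
Qed.

Lemma in_Zp_approx z (d : R) :
  in_Zp v z -> 0 < d -> exists m : nat, v (z - m%:R) < d.
Proof.
move=> Zz d0; have [[m|k] Hc] := Zz d d0; first by exists m.
have [N HN] := expr_lt_eventually (vp_itv R hp) d0.
(* A negative integer [-(k+1)] is replaced by the natural number [(k+1)(p^N - 1)], which differs
   from it by a multiple of [p^N]. *)
exists (k.+1 * (p ^ N - 1))%N; rewrite NegzE in Hc.
apply: (vB_lt_trans hK Hc).
rewrite mulnBr muln1 natrB; last by rewrite leq_pmulr // expn_gt0 prime_gt0.
rewrite opprB addrA rmorphN /= addNr sub0r (vN hK).
by apply: le_lt_trans (HN N (leqnn _)); apply: (v_dvdn hK hp); rewrite dvdn_mull.
Qed.

Section XtoZp.
Variable f : nat.
Implicit Type t : Xspace f p.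

(** Consecutive components are congruent modulo [f p^n], hence modulo [p^n], and the ultrametric
    inequality keeps the accumulated difference within the bound for the first step. *)
Lemma v_Xcomp t N n : (N <= n)%N -> v ((t n)%:R - (t N)%:R) <= p%:R^-1 ^+ N.
Proof.
have /andP[p0 /ltW p1] := vp_itv R hp.
move=> /subnKC <-; elim: (n - N)%N => [|k IHk].
  by rewrite addn0 subrr (v0 hK) exprn_ge0.
rewrite -(subrKA (t (N + k)%N)%:R); apply: (vD_le hK _ IHk).
apply: le_trans (_ : p%:R^-1 ^+ (N + k)%N <= _); last first.
  by apply: ler_wiXn2l; rewrite ?leq_addr.
rewrite addnS -[in X in _ - X](Xcompat t) -natrB ?leq_mod //.
apply: (v_dvdn hK hp); apply: (@dvdn_trans (f * p ^ (N + k))%N).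
  exact: dvdn_mull.
by rewrite -eqn_mod_dvd ?leq_mod // modn_mod.
Qed.

Lemma XtoZp_cvg t : pcvg v (fun N => (t N)%:R) (XtoZp v t).
Proof.
apply: (@xgetPex _ 0 [set l | pcvg v (fun N => (t N)%:R) l]%classic).
apply: (Cp_complete hK) => e /(expr_lt_eventually (vp_itv R hp))[N HN].
exists N => m n /(v_Xcomp t) Hm /(v_Xcomp t) Hn.
apply: (vB_lt_trans hK (b := (t N)%:R)); first exact: le_lt_trans Hm (HN _ _).
by rewrite (v_distrC hK); exact: le_lt_trans Hn (HN _ _).
Qed.

Lemma in_Zp_XtoZp t : in_Zp v (XtoZp v t).
Proof.
move=> e e0; have /(pcvgP hK)/(_ e e0)[N HN] := XtoZp_cvg t.
by exists (t N)%:Z; rewrite (v_distrC hK); exact: HN.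
Qed.

Lemma XtoZp_Xnat k : (0 < f)%N -> XtoZp v (Xnat f p k) = k%:R.
Proof.
(* The components are equal to [k] itself from [N = k] on, because [k <= N < p^N]. *)
move=> f0; apply: (plimE hK); apply: (@pcvg_near_const _ _ k) => N kN /=.
rewrite modn_small //; apply: (@leq_trans (p ^ N)%N); last exact: leq_pmull.
by apply: leq_ltn_trans kN _; exact/ltn_expl/prime_gt1.
Qed.

End XtoZp.

(** * Powers with p-adic integer exponents *)

Section Qpow.
Variable q : K.
Hypothesis hq : v (1 - q) < 1.

Let qpow_rel z y := forall e : R, 0 < e -> exists2 d : R, 0 < d &
  forall m : nat, v (z - m%:R) < d -> v (y - q ^+ m) < e.

(** Two candidates are compared through a common [q^m] with [m] near [z]; such [m] exist because [z]
    lies in Z_p. *)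
Let qpow_rel_unique z y y' :
  in_Zp v z -> qpow_rel z y -> qpow_rel z y' -> y = y'.
Proof.
move=> Zz zy zy'; apply: (v_eq hK) => e e0.
have [d d0 Hd] := zy e e0; have [d' d'0 Hd'] := zy' e e0.
have [|m] := @in_Zp_approx z (Num.min d d') Zz; first by rewrite lt_min d0.
rewrite lt_min => /andP[/Hd Hy /Hd' Hy'].
by apply: (vB_lt_trans hK Hy); rewrite (v_distrC hK).
Qed.

(** Natural numbers tending to [z] give a Cauchy sequence of powers by uniform continuity, which
    then also bounds the distance from its limit to every [q^m] with [m] near [z]. *)
Let qpow_rel_exists z : in_Zp v z -> exists y, qpow_rel z y.
Proof.
move=> Zz; have pN0 N : 0 < p%:R^-1 ^+ N :> R.
  by rewrite exprn_gt0 // invr_gt0 ltr0n prime_gt0.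
have [u Hu] := choice (fun N => in_Zp_approx Zz (pN0 N)).
have u_cvg d : 0 < d -> exists N, forall n, (N <= n)%N -> v (z - (u n)%:R) < d.
  move=> /(expr_lt_eventually (vp_itv R hp))[N HN].
  by exists N => n /HN; exact: lt_trans.
have [|y /(pcvgP hK) yu] := Cp_complete hK (u := fun n => q ^+ u n).
  move=> e /(base_uniform_cont hK hp hq)[d d0 Hd]; have [N HN] := u_cvg d d0.
  exists N => m n /HN Hm /HN Hn; apply: Hd.
  by apply: (vB_lt_trans hK (b := z)) => //; rewrite (v_distrC hK).
exists y => e e0; have [d d0 Hd] := base_uniform_cont hK hp hq e0.
exists d => // m Hm; have [N HN] := u_cvg d d0; have [N' HN'] := yu e e0.
apply: (vB_lt_trans hK (b := q ^+ u (maxn N N'))).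
  by rewrite (v_distrC hK); apply/HN'/leq_maxr.
apply/Hd/(vB_lt_trans hK (b := z)) => //.
by rewrite (v_distrC hK); apply/HN/leq_maxl.
Qed.

Lemma qpow_approx z : in_Zp v z -> forall e : R, 0 < e -> exists2 d : R, 0 < d &
  forall m : nat, v (z - m%:R) < d -> v (qpow v q z - q ^+ m) < e.
Proof. by move=> /qpow_rel_exists; exact: xgetPex. Qed.

Lemma v_qpow_le1 z : in_Zp v z -> v (qpow v q z) <= 1.
Proof.
move=> Zz; have [d d0 Hd] := qpow_approx Zz ltr01.
have [m /Hd Hm] := in_Zp_approx Zz d0.
rewrite -(subrK (q ^+ m) (qpow v q z)); apply: (vD_le hK); first exact: ltW.
by rewrite (vX hK) (v_base hK hq) expr1n.
Qed.

Lemma qpow_nat m : qpow v q m%:R = q ^+ m.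
Proof.
apply: (qpow_rel_unique (in_Zp_nat m)); first exact: qpow_approx (in_Zp_nat m).
move=> e /(base_uniform_cont hK hp hq)[d d0 Hd].
by exists d => // k; exact: Hd.
Qed.

(** The product satisfies the relation that characterises the power at [y + z]: it is close to
    [q^(k + l)] for naturals [k], [l] near [y], [z], all factors having absolute value at most 1,
    and [q^(k + l)] is close to [q^m] by uniform continuity. *)
Lemma qpowD y z : in_Zp v y -> in_Zp v z ->
  qpow v q (y + z) = qpow v q y * qpow v q z.
Proof.
move=> Zy Zz; have Zyz := in_ZpD Zy Zz.
apply: (qpow_rel_unique Zyz); first exact: qpow_approx.
move=> e e0; have [d d0 Hd] := base_uniform_cont hK hp hq e0.
have [dy dy0 Hy] := qpow_approx Zy e0; have [dz dz0 Hz] := qpow_approx Zz e0.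
exists d => // m Hm.
have [|k] := @in_Zp_approx y (Num.min d dy) Zy; first by rewrite lt_min d0.
rewrite lt_min => /andP[kd /Hy ky].
have [|l] := @in_Zp_approx z (Num.min d dz) Zz; first by rewrite lt_min d0.
rewrite lt_min => /andP[ld /Hz lz].
apply: (vB_lt_trans hK (b := q ^+ (k + l))); last first.
  apply: Hd; apply: (vB_lt_trans hK _ Hm).
  rewrite natrD (v_distrC hK) opprD addrACA; exact: (vD_lt hK).
rewrite exprD; apply: (vB_lt_trans hK (b := qpow v q y * q ^+ l)).
  rewrite -mulrBr (Cp_mul hK); apply: le_lt_trans lz.
  by rewrite ler_piMl ?(Cp_ge0 hK) // v_qpow_le1.
by rewrite -mulrBl (Cp_mul hK) (vX hK) (v_base hK hq) expr1n mulr1.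
Qed.

Lemma qpowMn z m : in_Zp v z -> qpow v q (z *+ m) = qpow v q z ^+ m.
Proof.
move=> Zz; elim: m => [|m IHm]; first exact: (qpow_nat 0%N).
by rewrite mulrS exprS qpowD ?IHm //; exact: in_ZpMn.
Qed.

Lemma qpow_sum r (z : 'I_r -> K) : (forall i, in_Zp v (z i)) ->
  qpow v q (\sum_(i < r) z i) = \prod_(i < r) qpow v q (z i).
Proof.
elim: r z => [|r IHr] z Zz; first by rewrite !big_ord0; exact: (qpow_nat 0%N).
by rewrite !big_ord_recl qpowD ?IHr //; exact: in_Zp_sum.
Qed.

End Qpow.
End Zp.

(** * Iterated linear operators on sums of products *)

Section Iterated.
Variables (T : Type) (K : fieldType) (op : (T -> K) -> K).
Variables (dom : (T -> K) -> Prop) (has : (T -> K) -> K -> Prop).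
Hypothesis has_op : forall g s, has g s -> op g = s /\ dom g.
Hypothesis has_lin : forall k (c : 'I_k -> K) (g : 'I_k -> T -> K) s,
  (forall l, has (g l) (s l)) ->
  has (fun t => \sum_(l < k) c l * g l t) (\sum_(l < k) c l * s l).

(** Serves the fermionic integral and the generalised sum alike, [has g s] being a sufficient
    condition for [op] to be defined at [g] with value [s]. The inner operators leave a combination
    of the [g l] in the first variable, to which linearity applies once more. *)
Lemma iterated_sum_prod k (g : 'I_k -> T -> K) (s : 'I_k -> K) r
    (c : 'I_k -> K) (F : r.-tuple T -> K) :
  (forall l, has (g l) (s l)) ->
  (forall ts, F ts = \sum_(l < k) c l * \prod_(i < r) g l (tnth ts i)) ->
  iterated op F = \sum_(l < k) c l * s l ^+ r /\ iterated_defined dom op F.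
Proof.
move=> gs; elim: r c F => [|r IHr] c F FE /=.
  by split=> //; rewrite FE; apply: eq_bigr => l _; rewrite big_ord0.
have inner t : iterated op (fun ts => F [tuple of t :: ts]) =
    \sum_(l < k) c l * s l ^+ r * g l t /\
    iterated_defined dom op (fun ts => F [tuple of t :: ts]).
  (* With the first variable frozen, its factor [g l t] joins the coefficients of the induction
     hypothesis. *)
  rewrite (eq_bigr (fun l => c l * g l t * s l ^+ r)); last first.
    by move=> l _; rewrite mulrAC.
  apply: IHr => ts; rewrite FE; apply: eq_bigr => l _.
  rewrite big_ord_recl tnth0 mulrA; congr (_ * _).
  by apply: eq_bigr => i _; rewrite tnthS.
have -> : (fun t => iterated op (fun ts => F [tuple of t :: ts])) =
    (fun t => \sum_(l < k) c l * s l ^+ r * g l t).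
  by apply/funext => t; case: (inner t).
have [-> ?] := has_op (has_lin (fun l => c l * s l ^+ r) gs).
split; last by split=> // t; case: (inner t).
by apply: eq_bigr => l _; rewrite exprSr mulrA.
Qed.

End Iterated.

(** * Finite sums over tuples and over residue classes *)

Lemma sum_tuple_prod (K : comNzRingType) f r (F : 'I_f -> K) :
  \sum_(a : r.-tuple 'I_f) \prod_(j < r) F (tnth a j) =
  (\sum_(a < f) F a) ^+ r.
Proof.
rewrite -[in RHS](card_ord r) -prodr_const bigA_distr_bigA /=.
rewrite (reindex (@finfun_of_tuple _ _)) /=; last first.
  exact/onW_bij/(Bijective (@finfun_of_tupleK _ _) (@tuple_of_finfunK _ _)).
by apply: eq_bigr => a _; apply: eq_bigr => j _; rewrite ffunE.
Qed.

(** The indices [f j + a] with [a < f] form the [j]-th block, which contributes [(y^f)^j] times the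
    first block. *)
Lemma sum_modn_geom (K : comNzRingType) f M (g : nat -> K) (y : K) :
  \sum_(k < f * M) g (k %% f)%N * y ^+ k =
  (\sum_(a < f) g a * y ^+ a) * \sum_(j < M) (y ^+ f) ^+ j.
Proof.
elim: M => [|M IHM]; first by rewrite muln0 !big_ord0 mulr0.
rewrite mulnS addnC big_split_ord IHM big_ord_recr mulrDr /=; congr (_ + _).
rewrite mulr_suml; apply: eq_bigr => a _.
by rewrite exprD exprM mulnC modnMDl modn_small // mulrA [RHS]mulrAC.
Qed.

(** * Rational generating functions *)

Section RationalGenerating.
Variable K : fieldType.
Implicit Types (Q D : {poly K}) (a : nat -> K).

(** The coefficient of [t^m] in [Q] times the generating series of [a], in the form in which
    [has_gsum] writes it. *)
Definition cauchy_prod Q a m := \sum_(i < m.+1) Q`_i * a (m - i)%N.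

(** Coefficient [m] sees only the first [m + 1] terms of [a], so the series can be truncated and
    polynomial algebra takes the place of power series. *)
Lemma cauchy_prod_poly Q a m B :
  (m < B)%N -> cauchy_prod Q a m = (Q * \poly_(i < B) a i)`_m.
Proof.
move=> mB; rewrite coefM; apply: eq_bigr => i _.
by rewrite coef_poly (leq_ltn_trans (leq_subr _ _) mB).
Qed.

Lemma cauchy_prodM Q Q' a m :
  cauchy_prod (Q' * Q) a m = cauchy_prod Q' (cauchy_prod Q a) m.
Proof.
rewrite (cauchy_prod_poly _ _ (leqnn m.+1)) -mulrA coefM; apply: eq_bigr => i _.
by rewrite -cauchy_prod_poly // ltnS leq_subr.
Qed.

(* The generating function of [a] is the rational function [D / Q], whose value
   at 1 is [S]. *)
Definition rational_gsum a S := exists Q D,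
  [/\ Q.[1] != 0, cauchy_prod Q a =1 (fun m => D`_m) & D.[1] = Q.[1] * S].

(** Induction on [k], adding fractions over the common denominator [Q' * Q]. *)
Lemma rational_gsum_lin k (c : 'I_k -> K) (g : 'I_k -> nat -> K) s :
  (forall l, rational_gsum (g l) (s l)) ->
  rational_gsum (fun t => \sum_(l < k) c l * g l t) (\sum_(l < k) c l * s l).
Proof.
elim: k c g s => [|k IHk] c g s gs.
  exists 1, 0; split; rewrite ?hornerC ?oner_eq0 ?big_ord0 ?mulr0 //.
  by move=> m; rewrite coef0 /cauchy_prod big1 // => i _; rewrite big_ord0 mulr0.
have [Q [D [Q1 QD D1]]] := gs ord0.
have [//|Q' [D' [Q'1 QD' D'1]]] := IHk (fun l => c (lift ord0 l))
  (fun l => g (lift ord0 l)) (fun l => s (lift ord0 l)).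
exists (Q' * Q), (c ord0 *: (Q' * D) + Q * D'); split.
- by rewrite hornerM mulf_neq0.
- move=> m; rewrite coefD coefZ !coefM.
  have -> : \sum_(i < m.+1) Q'`_i * D`_(m - i) = cauchy_prod (Q' * Q) (g ord0) m.
    by rewrite cauchy_prodM; apply: eq_bigr => i _; rewrite QD.
  rewrite (eq_bigr (fun i : 'I_m.+1 => Q`_i * cauchy_prod Q' (fun t =>
      \sum_(l < k) c (lift ord0 l) * g (lift ord0 l) t) (m - i))); last first.
    by move=> i _; rewrite QD'.
  rewrite -[X in _ + X]/(cauchy_prod Q (cauchy_prod Q' _) m) -cauchy_prodM.
  rewrite [Q * Q']mulrC.
  rewrite mulr_sumr -big_split /=; apply: eq_bigr => i _.
  by rewrite big_ord_recl mulrDr mulrCA.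
- rewrite hornerD hornerZ !hornerM D1 D'1 big_ord_recl; ring.
Qed.

(** Term [m] is [y^f] times term [m - f], so multiplication by [1 - y^f t^f] leaves only the first
    [f] terms. *)
Lemma rational_gsum_periodic f (g : nat -> K) (y : K) : (0 < f)%N ->
  1 - y ^+ f != 0 ->
  rational_gsum (fun m => g (m %% f)%N * y ^+ m)
    ((\sum_(a < f) g a * y ^+ a) / (1 - y ^+ f)).
Proof.
move=> f0 yf; exists (1 - y ^+ f *: 'X^f), (\poly_(i < f) (g i * y ^+ i)).
have Q1 : (1 - y ^+ f *: 'X^f).[1] = 1 - y ^+ f.
  by rewrite !hornerE expr1n mulr1.
split; rewrite ?Q1 //.
  move=> m; rewrite (cauchy_prod_poly _ _ (leqnn m.+1)).
  rewrite mulrBl mul1r coefB -scalerAl coefZ coefXnM !coef_poly leqnn.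
  case: ltnP => mf; first by rewrite mulr0 subr0 modn_small.
  rewrite ltnS leq_subr -[in X in X - _](subnK mf) modnDr exprD.
  ring.
rewrite mulrC divfK // horner_poly.
by apply: eq_bigr => a _; rewrite expr1n mulr1.
Qed.

(** By Pascal's rule each factor [1 - y t] lowers [r] by one, down to the constant series 1. *)
Lemma rational_gsum_negbin r (y : K) : 1 - y != 0 ->
  rational_gsum (fun m => 'C(m + r - 1, m)%:R * y ^+ m) ((1 - y)^-1 ^+ r).
Proof.
move=> y1; exists ((1 - y *: 'X) ^+ r), 1.
have Q1 : ((1 - y *: 'X) ^+ r).[1] = (1 - y) ^+ r.
  by rewrite horner_exp !hornerE.
split; rewrite ?Q1 ?expf_neq0 //; last first.
  by rewrite hornerC -exprMn divff // expr1n.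
elim: r {Q1} => [|r IHr] m.
  rewrite (cauchy_prod_poly _ _ (leqnn m.+1)) mul1r coef_poly leqnn coef1.
  (* At [r = 0] truncated subtraction gives ['C(0, 0) = 1] for [m = 0], while ['C(m - 1, m)]
     vanishes for positive [m]. *)
  case: m => [|m]; first by rewrite mulr1.
  by rewrite bin_small ?mul0r // addn0 subn1.
rewrite exprSr cauchy_prodM -[RHS]IHr; apply: eq_bigr => i _; congr (_ * _).
move: (m - i)%N => {i} {}m.
rewrite (cauchy_prod_poly _ _ (leqnn m.+1)) mulrBl mul1r coefB -scalerAl coefZ.
rewrite coefXM !coef_poly leqnn; case: m => [|m] /=.
  by rewrite mulr0 subr0 !bin0.
rewrite ltnS leqnSn addnS !subn1 /= mulrCA -exprS -mulrBl; congr (_ * _).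
by rewrite addSn addnS /= binS natrD addrK.
Qed.

End RationalGenerating.

(** * Values of the generalised sum and of the one-variable fermionic integral *)

Section Cp.
Variables (R : realType) (p : nat) (K : closedFieldType) (v : K -> R).
Hypothesis hK : is_Cp p v.

Lemma gsumE (a : nat -> K) S : has_gsum v a S -> gsum v a = S.
Proof.
by move=> aS; apply: xget_unique => // y /(has_gsum_unique hK)/(_ aS).
Qed.

(** The partial sums of the coefficients of [D] equal [D.[1]] from [size D] on, so the limit in
    [has_gsum] is attained after finitely many terms. *)
Lemma rational_gsumE (a : nat -> K) S :
  rational_gsum a S -> gsum v a = S /\ gsummable v a.
Proof.
move=> [Q [D [Q1 QD D1]]]; suff aS : has_gsum v a S.
  by split; [exact: gsumE | exists S].
exists Q => //; apply: (pcvg_near_const hK (N := size D)) => M DM.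
rewrite -D1 (horner_coef_wide _ DM); apply: eq_bigr => i _.
by rewrite expr1n mulr1 -QD.
Qed.

Lemma fermionic_integralE f (g : Xspace f p -> K) s :
  pcvg v (fermionic_sum g) s ->
  fermionic_integral v g = s /\ fermionic_integrable v g.
Proof. by move=> gs; split; [exact: (plimE hK) | exists s]. Qed.

Lemma fermionic_sum_lin f k (c : 'I_k -> K) (g : 'I_k -> Xspace f p -> K) s :
  (forall l, pcvg v (fermionic_sum (g l)) (s l)) ->
  pcvg v (fermionic_sum (fun t => \sum_(l < k) c l * g l t))
    (\sum_(l < k) c l * s l).
Proof.
elim: k c g s => [|k IHk] c g s gs.
  rewrite big_ord0; apply: (pcvg_near_const hK (N := 0)) => N _.
  by rewrite /fermionic_sum big1 // => i _; rewrite big_ord0 mul0r.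
rewrite big_ord_recl.
have := pcvgD hK (pcvgZ hK (c ord0) (gs ord0))
  (IHk (fun l => c (lift ord0 l)) _ _ (fun l => gs (lift ord0 l))).
congr (pcvg v _ _); apply/funext => N.
rewrite /fermionic_sum mulr_sumr -big_split; apply: eq_bigr => i _ /=.
by rewrite big_ord_recl mulrDl mulrA.
Qed.

Hypotheses (hp : prime p) (hp2 : odd p).
Variable q : K.
Hypothesis hq : v (1 - q) < 1.

(** If [q^m = -1], then [1 - q^m = 2] has absolute value 1 because [p] is odd, whereas it must be
    below 1. *)
Lemma base_add1_neq0 m : 1 + q ^+ m != 0.
Proof.
apply/negP; rewrite addrC addr_eq0 => /eqP qm.
by have := v_baseX_lt hK hq m; rewrite qm opprK (v2 hK hp hp2) ltxx.
Qed.

Lemma fermionic_sum_char_cvg f (chi : int -> K) l : odd f ->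
  pcvg v (fermionic_sum (fun t : Xspace f p =>
            chiX chi t * qpow v q (XtoZp v t) ^+ l))
    (2 * ((\sum_(a < f) chi a%:Z * (- q ^+ l) ^+ a) / (1 + q ^+ (l * f)))).
Proof.
move=> hf; set T := \sum_(a < f) _; set w := 1 + _.
have f0 : (0 < f)%N by case: (f) hf.
have w0 : w != 0 := base_add1_neq0 _.
have sumE N : fermionic_sum (fun t : Xspace f p =>
    chiX chi t * qpow v q (XtoZp v t) ^+ l) N =
    T / w * (1 + q ^+ (p ^ N * (l * f))).
  rewrite /fermionic_sum.
  (* The sign [(-1)^k] of the fermionic sum merges with [(q^k)^l] into [(- q^l)^k]. *)
  transitivity (\sum_(k < f * p ^ N)
      chi (k %% f)%N%:Z * (- q ^+ l) ^+ k).
    apply: eq_bigr => k _.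
    rewrite /chiX /= expn0 muln1 (XtoZp_Xnat hK hp) // (qpow_nat hK hp hq).
    by rewrite -mulrA; congr (_ * _); rewrite [RHS]exprNn mulrC exprAC.
  rewrite (sum_modn_geom _ _ (fun a => chi a%:Z)) -/T -mulrA; congr (_ * _).
  apply: (mulfI w0); rewrite mulVKf //.
  (* As [f] is odd, the geometric sum has ratio [- q^(l f)]. Multiplied by the ratio minus 1, which
     is [- w], it telescopes, and the oddness of [p^N] gives [- (1 + q^(p^N l f))]. *)
  have -> : (- q ^+ l) ^+ f = - q ^+ (l * f).
    by rewrite exprNn -signr_odd hf mulN1r exprM.
  rewrite -[RHS]opprK -[w]opprK mulNr; congr (- _).
  have -> : - w = - q ^+ (l * f) - 1 by rewrite opprD addrC.
  rewrite -subrX1 exprNn -signr_odd oddX hp2 orbT mulN1r -exprM.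
  by rewrite [(l * f * _)%N]mulnC opprD addrC.
(* The exponent is a multiple of [p^N], so this power of [q] tends to 1 and the bracket to 2. *)
rewrite mulrC (_ : fermionic_sum _ = fun N => T / w * (1 + q ^+ (p ^ N * (l * f)))).
  apply: (pcvgZ hK); apply/(pcvgP hK) => e /(v_baseXX_lt hK hp hq)[N HN].
  exists N => k /(HN k (l * f)%N); rewrite -(vN hK).
  by congr (v _ < e); ring.
by apply/funext => N; rewrite sumE.
Qed.

End Cp.

(** * The r-fold integral and its three expressions *)

Unset Implicit Arguments.
Set Strict Implicit.

Theorem theorem2 (R : realType) (p : nat) (hp : prime p) (hp2 : odd p)
    (K : closedFieldType) (v : K -> R) (hK : is_Cp p v)
    (q : K) (hq : v (1 - q) < 1)
    (f : nat) (hf : odd f) (chi : int -> K) (hchi : has_conductor f chi)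
    (r n : nat) (hr : (0 < r)%N) (x : K) (hx : in_Zp v x) :
  let E := euler_poly v f p chi q r n x in
  let A :=
    2 ^+ r / (1 - q) ^+ n *
    \sum_(l < n.+1) 'C(n, l)%:R * qpow v q (l%:R * x) * (-1) ^+ l *
      \sum_(a : r.-tuple 'I_f)
        (\prod_(j < r) chi (tnth a j)%:Z) *
        ((- q ^+ l) ^+ (\sum_(i < r) tnth a i)%N / (1 + q ^+ (l * f)) ^+ r) in
  let b := fun m : nat =>
    'C(m + r - 1, m)%:R * (-1) ^+ m *
    \sum_(a : r.-tuple 'I_f)
      (\prod_(j < r) chi (tnth a j)%:Z) *
      (-1) ^+ (\sum_(i < r) tnth a i)%N *
      qnum v q (\sum_(j < r) (tnth a j)%:R + x + (m * f)%:R) ^+ n in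
  let c := fun ms : r.-tuple nat =>
    (-1) ^+ (\sum_(i < r) tnth ms i)%N *
    (\prod_(i < r) chi (tnth ms i)%:Z) *
    qnum v q (x + \sum_(i < r) (tnth ms i)%:R) ^+ n in
  [/\ euler_poly_defined v f p chi q r n x,
      gsummable v b &
      iterated_defined (gsummable v) (gsum v) c] /\
  [/\ E = A,
      A = 2 ^+ r * gsum v b &
      2 ^+ r * gsum v b = 2 ^+ r * iterated (gsum v) c].
Proof.
move=> E A b c; have [hdc _] := hchi.
have f0 : (0 < f)%N by case: (f) hf.
(* [d l] is the coefficient of [q^(l z)] in the expansion of [[z + x]_q^n]. Up to the factor [2^r],
   everything is brought to the sum of [d l * (T l / w l) ^+ r]. *)
pose y (l : nat) := - q ^+ l; pose w l := 1 + q ^+ (l * f).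
pose T (l : nat) := \sum_(a < f) chi a%:Z * y l ^+ a.
pose d (l : 'I_n.+1) :=
  (1 - q) ^- n * ('C(n, l)%:R * (-1) ^+ l) * qpow v q x ^+ l.
have w0 l : w l != 0 by exact: (base_add1_neq0 hK hp hp2 hq).
have yfE l : y l ^+ f = - q ^+ (l * f).
  by rewrite /y exprNn -signr_odd hf mulN1r -exprM.
have yf l : 1 - y l ^+ f = w l by rewrite yfE opprK.
have chi_mod m : chi (m %% f)%N%:Z = chi m%:Z.
  by apply: (dchar_periodic hdc); rewrite !modz_nat modn_mod.
(* No case distinction at [q = 1]: both sides carry the inverse of [(1 - q)^n] under the same
   convention. *)
have qnumE z : in_Zp v z -> qnum v q (z + x) ^+ n =
    \sum_(l < n.+1) d l * qpow v q z ^+ l.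
  move=> Zz; rewrite /qnum (qpowD hK hp hq Zz hx) expr_div_n exprBn mulrC.
  rewrite mulr_sumr; apply: eq_bigr => l _.
  by rewrite expr1n mulr1 exprMn -mulr_natl /d; ring.
have [EE Edef] : E = \sum_(l < n.+1) d l * (2 * (T l / w l)) ^+ r /\
    euler_poly_defined v f p chi q r n x.
  rewrite /E /euler_poly /euler_poly_defined.
  (* Here [has] is convergence of the fermionic sums, and the [l]-th product has the factors
     [chi(x_i) q^(l x_i)]. *)
  refine (@iterated_sum_prod _ K _ _ (fun g => pcvg v (@fermionic_sum K f p g))
    (@fermionic_integralE _ _ _ _ hK f) (@fermionic_sum_lin _ _ _ _ hK f) _
   (fun l t => chiX chi t * qpow v q (XtoZp v t) ^+ l)
    (fun l : 'I_n.+1 => 2 * (T l / w l)) _ d _ _ _).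
  - by move=> l; exact: fermionic_sum_char_cvg.
  move=> ts; rewrite /euler_integrand qnumE; last first.
    by apply: (in_Zp_sum hK) => i; exact: (in_Zp_XtoZp hK hp).
  rewrite mulr_sumr; apply: eq_bigr => l _.
  rewrite (qpow_sum hK hp hq); last by move=> i; exact: (in_Zp_XtoZp hK hp).
  by rewrite big_split prodrXl mulrCA.
have tupleE (l : nat) : \sum_(a : r.-tuple 'I_f) (\prod_(j < r) chi (tnth a j)%:Z) *
    y l ^+ (\sum_(i < r) tnth a i)%N = T l ^+ r.
  rewrite -(sum_tuple_prod _ (fun a : 'I_f => chi a%:Z * y l ^+ a)).
  by apply: eq_bigr => a _; rewrite big_split prodrXr.
have AE : A = 2 ^+ r * \sum_(l < n.+1) d l * (T l / w l) ^+ r.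
  rewrite /A -mulrA; congr (_ * _); rewrite mulr_sumr; apply: eq_bigr => l _.
  rewrite (eq_bigr (fun a : r.-tuple 'I_f => (\prod_(j < r) chi (tnth a j)%:Z) *
    y l ^+ (\sum_(i < r) tnth a i)%N * (w l ^+ r)^-1)); last first.
    by move=> a _; rewrite mulrA.
  rewrite -mulr_suml tupleE (mulr_natl x) (qpowMn hK hp hq _ hx) expr_div_n /d.
  ring.
have [bE bsum] : gsum v b = \sum_(l < n.+1) d l * (T l / w l) ^+ r /\
    gsummable v b.
  (* Expanding and exchanging sums leaves, for each [l], a negative binomial series in [(y l)^f]: as
     [f] is odd, [(-1)^m q^(l m f)] is the [m]-th power of [(y l)^f]. *)
  have -> : b = fun m => \sum_(l < n.+1)
      d l * T l ^+ r * ('C(m + r - 1, m)%:R * (y l ^+ f) ^+ m).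
    apply/funext => m; rewrite /b.
    rewrite (eq_bigr (fun a : r.-tuple 'I_f => \sum_(l < n.+1)
        d l * (q ^+ (m * f)) ^+ l * ((\prod_(j < r) chi (tnth a j)%:Z) *
          y l ^+ (\sum_(i < r) tnth a i)%N))); last first.
      move=> a _; rewrite addrAC -natr_sum -natrD qnumE; last exact: (in_Zp_nat hK).
      rewrite (qpow_nat hK hp hq) mulr_sumr; apply: eq_bigr => l _.
      move: (\sum_(i < r) tnth a i)%N => s.
      rewrite [y l ^+ s]exprNn exprD exprMn [q ^+ s ^+ l]exprAC; ring.
    rewrite exchange_big mulr_sumr; apply: eq_bigr => l _.
    rewrite -mulr_sumr tupleE yfE [(- q ^+ (l * f)) ^+ m]exprNn.
    by rewrite -!exprM [(m * f * l)%N]mulnC mulnA [(l * m * f)%N]mulnAC; ring.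
  have -> : \sum_(l < n.+1) d l * (T l / w l) ^+ r =
      \sum_(l < n.+1) d l * T l ^+ r * (1 - y l ^+ f)^-1 ^+ r.
    by apply: eq_bigr => l _; rewrite yf exprMn mulrA.
  apply: (rational_gsumE hK); apply: rational_gsum_lin => l.
  by apply: rational_gsum_negbin; rewrite yf.
have [cE csum] : iterated (gsum v) c = \sum_(l < n.+1) d l * (T l / w l) ^+ r /\
    iterated_defined (gsummable v) (gsum v) c.
  (* Here [has] is [rational_gsum]; the periodicity of [chi] modulo [f] brings each one-variable
     sequence under [rational_gsum_periodic]. *)
  refine (@iterated_sum_prod _ K _ _ _ (@rational_gsumE _ _ _ _ hK)
    (@rational_gsum_lin K) _ (fun l m => chi m%:Z * y l ^+ m)
    (fun l : 'I_n.+1 => T l / w l) _ d _ _ _).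
    move=> l; rewrite -yf.
    have := rational_gsum_periodic (fun a => chi a%:Z) f0 (y := y l).
    rewrite yf => /(_ (w0 l)); congr rational_gsum.
    by apply/funext => m; rewrite chi_mod.
  move=> ts; rewrite /c addrC qnumE; last first.
    by apply: (in_Zp_sum hK) => i; exact: (in_Zp_nat hK).
  rewrite mulr_sumr; apply: eq_bigr => l _.
  rewrite -natr_sum (qpow_nat hK hp hq) big_split /= prodrXr.
  move: (\sum_(i < r) tnth ts i)%N => s.
  by rewrite [y l ^+ s]exprNn [q ^+ s ^+ l]exprAC; ring.
split; split=> //.
- rewrite EE AE mulr_sumr; apply: eq_bigr => l _.
  by rewrite [in LHS]exprMn mulrCA.
- by rewrite AE bE.
- by rewrite bE cE.
Qed.
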